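(* Let $G$ be a compact Lie group and $X$ a compact $G$-ANR. Then $$TC(X^G)\leqslant TC_G(X)\quad\text{and}\quad TC(X^G)\leqslant TC^G(X).$$
   Context: A $G$-ANR is a metrizable $G$-space which is an equivariant neighbourhood retract of every metrizable $G$-space containing it as a closed $G$-invariant subspace. $X^G$ is the fixed point subspace. $TC_G(X)$ is the least $n$ such that $X\times X$ (with diagonal $G$-action) is covered by $n$ open $G$-invariant sets $U_i$, each admitting a $G$-map $s_i\colon U_i\to PX$ with $\pi\circ s_i$ equal to the inclusion $U_i\subseteq X\times X$; here $PX$ is the space of paths $[0,1]\to X$ with pointwise $G$-action and $\pi(\gamma)=(\gamma(0),\gamma(1))$. For a space $Y$, $TC(Y)$ is this invariant for the trivial group. For a group $K$, a $K$-space $Z$ and closed $K$-invariant $A\subseteq Z$, an open $K$-invariant $U\subseteq Z$ is $K$-compressible into $A$ if the inclusion $U\subseteq Z$ is $K$-homotopic to a $K$-map $c\colon U\to Z$ with $c(U)\subseteq A$; ${}_A\mathrm{cat}_K(Z)$ is the least $n$ such that $Z$ is covered by $n$ open $K$-invariant subsets each $K$-compressible into $A$. With $G\times G$ acting on $X\times X$ by $(g_1,g_2)(x_1,x_2)=(g_1x_1,g_2x_2)$, $\Delta(X)$ the diagonal and $\daleth(X):=(G\times G)\cdot\Delta(X)$, set $TC^G(X):={}_{\daleth(X)}\mathrm{cat}_{G\times G}(X\times X)$. All these numbers are $\infty$ if no such $n$ exists. *)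

(* Defs.v *)
From HB Require Import structures.
From mathcomp Require Import all_boot all_order all_algebra.
From mathcomp Require Import all_classical all_reals all_analysis.

Set Implicit Arguments.
Unset Strict Implicit.
Unset Printing Implicit Defensive.

Import Order.TTheory GRing.Theory Num.Theory.
Import numFieldNormedType.Exports.

Local Open Scope classical_set_scope.
Local Open Scope ring_scope.

HB.mixin Record isTopologicalGroup G & Topological G & Group G := {
  mulg_continuous : continuous (fun p : G * G => (p.1 * p.2)%g);
  invg_continuous : continuous (fun x : G => (x^-1)%g)
}.

#[short(type="topologicalGroupType")]
HB.structure Definition TopologicalGroup :=
  { G of Topological G & Group G & isTopologicalGroup G }.

Section ProductGroup.
Variables G H : topologicalGroupType.

Let prod_mulg_continuous :
  continuous (fun p : (G * H) * (G * H) => (p.1 * p.2)%g).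
Proof.
move=> [[g h] [g' h']]; apply: (@cvg_pair _ _ _ _ (nbhs (g * g')%g)
  (nbhs (h * h')%g)) => /=.
- apply: (@cvg_comp _ _ _ (fun p : (G * H) * (G * H) => (p.1.1, p.2.1))
    (fun p : G * G => (p.1 * p.2)%g) _ (nbhs (g, g')));
    last exact: (@mulg_continuous G (g, g')).
  by apply: cvg_pair; (apply: cvg_comp; [exact: cvg_fst || exact: cvg_snd|
    exact: cvg_fst]).
- apply: (@cvg_comp _ _ _ (fun p : (G * H) * (G * H) => (p.1.2, p.2.2))
    (fun p : H * H => (p.1 * p.2)%g) _ (nbhs (h, h')));
    last exact: (@mulg_continuous H (h, h')).
  by apply: cvg_pair; (apply: cvg_comp; [exact: cvg_fst || exact: cvg_snd|
    exact: cvg_snd]).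
Qed.

Let prod_invg_continuous : continuous (fun p : G * H => (p^-1)%g).
Proof.
move=> [g h]; apply: (@cvg_pair _ _ _ _ (nbhs (g^-1)%g) (nbhs (h^-1)%g)) => /=.
- by apply: cvg_comp; [exact: cvg_fst|exact: invg_continuous].
- by apply: cvg_comp; [exact: cvg_snd|exact: invg_continuous].
Qed.

HB.instance Definition _ := isTopologicalGroup.Build (G * H)%type
  prod_mulg_continuous prod_invg_continuous.

End ProductGroup.

(* An alias, so that [unit] itself receives no topology or group law. *)
Definition trivial_group : Type := unit.

Section TrivialGroup.
Let tmul (_ _ : trivial_group) : trivial_group := tt.
Let tinv (_ : trivial_group) : trivial_group := tt.
Let tmulA : associative tmul. Proof. by []. Qed.
Let tmul1 : left_id (tt : trivial_group) tmul. Proof. by case. Qed.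
Let tmulr1 : right_id (tt : trivial_group) tmul. Proof. by case. Qed.
Let tmulV : left_inverse (tt : trivial_group) tinv tmul. Proof. by []. Qed.
Let tmulrV : right_inverse (tt : trivial_group) tinv tmul. Proof. by []. Qed.

HB.instance Definition _ := Choice.copy trivial_group unit.
HB.instance Definition _ :=
  Topological.copy trivial_group (discrete_topology unit).
HB.instance Definition _ :=
  isGroup.Build trivial_group tmulA tmul1 tmulr1 tmulV tmulrV.

Let tmul_continuous :
  continuous (fun p : trivial_group * trivial_group => (p.1 * p.2)%g).
Proof. by move=> p; exact: cvg_cst. Qed.
Let tinv_continuous : continuous (fun x : trivial_group => (x^-1)%g).
Proof. by move=> p; exact: cvg_cst. Qed.

HB.instance Definition _ := isTopologicalGroup.Build trivial_group
  tmul_continuous tinv_continuous.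
End TrivialGroup.

Section LieGroups.
Variable R : realType.

Fixpoint class_C (V W : normedModType R) (k : nat) (U : set V) (f : V -> W)
    : Prop :=
  (forall x, U x -> {for x, continuous f}) /\
  match k with
  | 0 => True
  | k'.+1 => forall v : V,
      (forall x, U x -> derivable f x v) /\ class_C k' U ('D_v f)
  end.

(* Meant for open [U] and finite-dimensional [V], where the existence and
   continuity of all iterated directional derivatives is the usual C^oo. *)
Definition smooth_on (V W : normedModType R) (U : set V) (f : V -> W) : Prop :=
  forall k, class_C k U f.

(* [chart_map] only matters on [chart_dom], and [chart_inv] only on the image
   of [chart_dom]. *)
Record chart (M : topologicalType) (E : normedModType R) := Chart {
  chart_dom : set M;
  chart_map : M -> E;
  chart_inv : E -> M
}.

Definition is_chart (M : topologicalType) (E : normedModType R)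
    (c : chart M E) : Prop :=
  [/\ open (chart_dom c),
      open (chart_map c @` chart_dom c),
      {in chart_dom c, cancel (chart_map c) (chart_inv c)},
      {within chart_dom c, continuous (chart_map c)} &
      {within chart_map c @` chart_dom c, continuous (chart_inv c)}].

Definition smooth_in_charts (M N : topologicalType) (E F : normedModType R)
    (A : set (chart M E)) (B : set (chart N F)) (f : M -> N) : Prop :=
  forall c d, A c -> B d ->
    smooth_on (chart_map c @` (chart_dom c `&` f @^-1` chart_dom d))
              (chart_map d \o f \o chart_inv c).

Definition smooth_atlas (M : topologicalType) (E : normedModType R)
    (A : set (chart M E)) : Prop :=
  [/\ forall c, A c -> is_chart c,
      \bigcup_(c in A) chart_dom c = [set: M] &
      smooth_in_charts A A id].

Definition prod_chart (M N : topologicalType) (E F : normedModType R)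
    (c : chart M E) (d : chart N F) : chart (M * N)%type (E * F)%type :=
  Chart (chart_dom c `*` chart_dom d)
        (fun p => (chart_map c p.1, chart_map d p.2))
        (fun p => (chart_inv c p.1, chart_inv d p.2)).

Definition prod_atlas (M N : topologicalType) (E F : normedModType R)
    (A : set (chart M E)) (B : set (chart N F)) :
    set (chart (M * N)%type (E * F)%type) :=
  [set prod_chart c d | c in A & d in B].

Definition lie_group (G : topologicalGroupType) : Prop :=
  [/\ hausdorff_space G,
      @second_countable G &
      exists (n : nat) (A : set (chart G 'rV[R]_n)),
        [/\ smooth_atlas A,
            smooth_in_charts (prod_atlas A A) A
              (fun p : G * G => (p.1 * p.2)%g) &
            smooth_in_charts A A (fun x : G => (x^-1)%g)]].

End LieGroups.

Record gaction (G : topologicalGroupType) (X : topologicalType) := GAction {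
  gact :> G -> X -> X;
  gact1 : forall x, gact 1%g x = x;
  gactM : forall g h x, gact (g * h)%g x = gact g (gact h x);
  gact_continuous : continuous (fun p : G * X => gact p.1 p.2)
}.

Section GSpaces.
Variables (G : topologicalGroupType) (X : topologicalType) (a : gaction G X).

Definition fixed_points : set X := [set x | forall g, a g x = x].

Definition ginvariant (A : set X) : Prop := forall g x, A x -> A (a g x).

Definition gsaturation (A : set X) : set X :=
  [set a g x | g in [set: G] & x in A].

Lemma gact_continuous_at (g : G) : continuous (a g).
Proof.
move=> x; apply: (@cvg_comp _ _ _ (fun x => (g, x)) (fun p : G * X => a p.1 p.2)
  _ (nbhs (g, x))); last exact: (@gact_continuous _ _ a (g, x)).
by apply: cvg_pair; [exact: cvg_cst|exact: cvg_id].
Qed.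

Lemma diag_act1 (p : X * X) : (a 1%g p.1, a 1%g p.2) = p.
Proof. by rewrite !gact1 -surjective_pairing. Qed.

Lemma diag_actM g h (p : X * X) : (a (g * h)%g p.1, a (g * h)%g p.2) =
  (a g (a h p.1, a h p.2).1, a g (a h p.1, a h p.2).2).
Proof. by rewrite !gactM. Qed.

Lemma diag_act_continuous :
  continuous (fun q : G * (X * X) => (a q.1 q.2.1, a q.1 q.2.2)).
Proof.
move=> [g [x y]]; apply: (@cvg_pair _ _ _ _ (nbhs (a g x)) (nbhs (a g y))) => /=.
- apply: (@cvg_comp _ _ _ (fun q : G * (X * X) => (q.1, q.2.1))
    (fun q : G * X => a q.1 q.2) _ (nbhs (g, x)));
    last exact: (@gact_continuous _ _ a (g, x)).
  by apply: cvg_pair; [exact: cvg_fst|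
    apply: cvg_comp; [exact: cvg_snd|exact: cvg_fst]].
- apply: (@cvg_comp _ _ _ (fun q : G * (X * X) => (q.1, q.2.2))
    (fun q : G * X => a q.1 q.2) _ (nbhs (g, y)));
    last exact: (@gact_continuous _ _ a (g, y)).
  by apply: cvg_pair; [exact: cvg_fst|
    apply: cvg_comp; [exact: cvg_snd|exact: cvg_snd]].
Qed.

Definition diag_action : gaction G (X * X)%type :=
  GAction (gact := fun g p => (a g p.1, a g p.2))
    diag_act1 diag_actM diag_act_continuous.

Lemma square_act1 (p : X * X) :
  (a (1 : G * G)%g.1 p.1, a (1 : G * G)%g.2 p.2) = p.
Proof. exact: diag_act1. Qed.

Lemma square_actM (g h : G * G) (p : X * X) :
  (a (g * h)%g.1 p.1, a (g * h)%g.2 p.2) =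
  (a g.1 (a h.1 p.1, a h.2 p.2).1, a g.2 (a h.1 p.1, a h.2 p.2).2).
Proof. by rewrite !gactM. Qed.

Lemma square_act_continuous :
  continuous (fun q : (G * G) * (X * X) => (a q.1.1 q.2.1, a q.1.2 q.2.2)).
Proof.
move=> [[g h] [x y]].
apply: (@cvg_pair _ _ _ _ (nbhs (a g x)) (nbhs (a h y))) => /=.
- apply: (@cvg_comp _ _ _ (fun q : (G * G) * (X * X) => (q.1.1, q.2.1))
    (fun q : G * X => a q.1 q.2) _ (nbhs (g, x)));
    last exact: (@gact_continuous _ _ a (g, x)).
  by apply: cvg_pair; apply: cvg_comp;
    [exact: cvg_fst|exact: cvg_fst|exact: cvg_snd|exact: cvg_fst].
- apply: (@cvg_comp _ _ _ (fun q : (G * G) * (X * X) => (q.1.2, q.2.2))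
    (fun q : G * X => a q.1 q.2) _ (nbhs (h, y)));
    last exact: (@gact_continuous _ _ a (h, y)).
  by apply: cvg_pair; apply: cvg_comp;
    [exact: cvg_fst|exact: cvg_snd|exact: cvg_snd|exact: cvg_snd].
Qed.

Definition square_action : gaction (G * G)%type (X * X)%type :=
  GAction (gact := fun (g : G * G) p => (a g.1 p.1, a g.2 p.2))
    square_act1 square_actM square_act_continuous.

End GSpaces.

Section TrivialAction.
Variable X : topologicalType.

Let triv (_ : trivial_group) (x : X) := x.
Let triv1 x : triv 1%g x = x. Proof. by []. Qed.
Let trivM g h x : triv (g * h)%g x = triv g (triv h x). Proof. by []. Qed.
Let triv_continuous : continuous (fun p : trivial_group * X => triv p.1 p.2).
Proof. by move=> p; exact: cvg_snd. Qed.

Definition trivial_action : gaction trivial_group X :=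
  GAction triv1 trivM triv_continuous.

End TrivialAction.

(* A [G]-map [U -> Y], given by a function on the ambient space whose values
   outside the invariant set [U] are irrelevant. *)
Definition gmap_on (G : Type) (X Y : topologicalType) (aX : G -> X -> X)
    (aY : G -> Y -> Y) (U : set X) (f : X -> Y) : Prop :=
  {within U, continuous f} /\ forall g x, U x -> f (aX g x) = aY g (f x).

Definition metrizable (R : realType) (X : topologicalType) : Prop :=
  exists (M : metricType R) (f : X -> M) (h : M -> X),
    [/\ continuous f, continuous h, cancel f h & cancel h f].

Definition closed_embedding (X Y : topologicalType) (i : X -> Y) : Prop :=
  [/\ injective i, continuous i, closed (range i) &
      forall O : set X, open O -> exists2 O', open O' & i @^-1` O' = O].

(* The retraction is a map [Y -> Y] with values in the image of [i], rather
   than a map [Y -> X], so that the empty space is not excluded. *)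
Definition gANR (R : realType) (G : topologicalGroupType) (X : topologicalType)
    (a : gaction G X) : Prop :=
  metrizable R X /\
  forall (Y : topologicalType) (b : gaction G Y) (i : X -> Y),
    metrizable R Y -> closed_embedding i ->
    (forall g x, i (a g x) = b g (i x)) ->
    exists (U : set Y) (r : Y -> Y),
      [/\ open U, ginvariant b U, range i `<=` U,
          gmap_on b b U r &
          r @` U `<=` range i /\ forall x, r (i x) = i x].

Section UnitInterval.
Variable R : realType.

Definition unit_interval : topologicalType :=
  set_type (`[0, 1]%classic : set R).

Lemma mem_unit_interval (t : R) : 0 <= t <= 1 -> t \in (`[0, 1]%classic : set R).
Proof. by move=> t01; rewrite inE /= in_itv. Qed.

Definition I0 : unit_interval :=
  exist _ 0 (mem_unit_interval (introT andP (conj (lexx 0) ler01))).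
Definition I1 : unit_interval :=
  exist _ 1 (mem_unit_interval (introT andP (conj ler01 (lexx 1)))).

Variable X : topologicalType.

Definition path_space : Type := continuousType unit_interval X.

Definition path_fun (w : path_space) : {compact-open, unit_interval -> X} :=
  (w : continuousType unit_interval X).

HB.instance Definition _ := Choice.on path_space.
HB.instance Definition _ :=
  Topological.copy path_space (initial_topology path_fun).

Definition path_ends (w : path_space) : X * X :=
  (path_fun w I0, path_fun w I1).

Lemma path_act_continuous (G : topologicalGroupType) (a : gaction G X) (g : G)
  (w : continuousType unit_interval X) : continuous (a g \o w).
Proof.
by move=> t; apply: continuous_comp; [exact: cts_fun|exact: (@gact_continuous_at G X a)].
Qed.

Definition path_act (G : topologicalGroupType) (a : gaction G X) (g : G)
    (w : path_space) : path_space :=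
  mkcts (@path_act_continuous G a g w).

End UnitInterval.

(* [ereal_inf set0 = +oo]: the value is [+oo] if no [n] satisfies [P]. *)
Definition least_number (R : realType) (P : set nat) : \bar R :=
  ereal_inf [set n%:R%:E | n in P].

Definition gcovered (G : topologicalGroupType) (Z : topologicalType)
    (b : gaction G Z) (good : set (set Z)) (n : nat) : Prop :=
  exists U : 'I_n -> set Z,
    (forall i, [/\ open (U i), ginvariant b (U i) & good (U i)]) /\
    \bigcup_i U i = [set: Z].

Definition has_motion_planner (R : realType) (G : topologicalGroupType)
    (X : topologicalType) (a : gaction G X) (U : set (X * X)) : Prop :=
  exists s : X * X -> path_space R X,
    gmap_on (diag_action a) (path_act a) U s /\
    forall p, U p -> path_ends (s p) = p.

Definition TC_equivariant (R : realType) (G : topologicalGroupType)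
    (X : topologicalType) (a : gaction G X) : \bar R :=
  least_number R (gcovered (diag_action a) (has_motion_planner R a)).

Definition TC (R : realType) (Y : topologicalType) : \bar R :=
  TC_equivariant R (trivial_action Y).

Definition ghomotopic_on (R : realType) (K : topologicalGroupType)
    (Z : topologicalType) (b : gaction K Z) (U : set Z) (f h : Z -> Z) : Prop :=
  exists H : Z * unit_interval R -> Z,
    [/\ {within U `*` [set: unit_interval R], continuous H},
        forall g z t, U z -> H (b g z, t) = b g (H (z, t)),
        forall z, U z -> H (z, I0 R) = f z &
        forall z, U z -> H (z, I1 R) = h z].

(* As in [gmap_on], [c] and the homotopy only matter over [U]. *)
Definition gcompressible (R : realType) (K : topologicalGroupType)
    (Z : topologicalType) (b : gaction K Z) (A U : set Z) : Prop :=
  exists c : Z -> Z,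
    [/\ gmap_on b b U c, c @` U `<=` A & ghomotopic_on R b U id c].

(* [A] is meant to be closed and [K]-invariant; the value makes sense, and is
   defined, for every [A]. *)
Definition gcat (R : realType) (K : topologicalGroupType) (Z : topologicalType)
    (b : gaction K Z) (A : set Z) : \bar R :=
  least_number R (gcovered b (gcompressible R b A)).

Definition diagonal_set (X : Type) : set (X * X) := range (fun x => (x, x)).

Definition daleth (G : topologicalGroupType) (X : topologicalType)
    (a : gaction G X) : set (X * X) :=
  gsaturation (square_action a) (@diagonal_set X).

Definition TC_effective (R : realType) (G : topologicalGroupType)
    (X : topologicalType) (a : gaction G X) : \bar R :=
  gcat R (square_action a) (daleth a).

(* Main.v *)
(* A group element acts trivially on [X^G], so an equivariant map sends points
   of [X^G] to points of [X^G].  Hence an equivariant motion planner restricts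
   to [X^G].  For the second inequality, an equivariant compression of [U] into
   the saturation of the diagonal restricts to a homotopy inside
   [X^G * X^G], and a point [(g x, h x)] with both coordinates fixed is on the
   diagonal.  The homotopy thus moves both endpoints to a common point, and the
   track of the first coordinate followed by the reversed track of the second
   is a motion planner. *)
Require Import Defs.
From mathcomp Require Import all_boot all_order all_algebra.
From mathcomp Require Import all_classical all_reals all_analysis.
From mathcomp Require Import lra.

Set Implicit Arguments.
Unset Strict Implicit.
Unset Printing Implicit Defensive.

Import Order.TTheory GRing.Theory Num.Theory.
Import numFieldNormedType.Exports.

Local Open Scope classical_set_scope.
Local Open Scope ring_scope.

Lemma set_val_continuous (X : topologicalType) (A : set X) :
  continuous (set_val : A -> X).
Proof. exact: initial_continuous. Qed.

Lemma within_openE (X Y : topologicalType) (U : set X) (f : X -> Y) :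
  open U ->
  {within U, continuous f} <-> forall x, U x -> {for x, continuous f}.
Proof.
move=> oU; rewrite continuous_open_subspace //.
by split=> cf x; [move/mem_set/cf|move/set_mem/cf].
Qed.

Lemma continuous_pair (X Y Z : topologicalType) (f : X -> Y) (g : X -> Z)
    (x : X) : {for x, continuous f} -> {for x, continuous g} ->
  {for x, continuous (fun x => (f x, g x))}.
Proof. exact: cvg_pair. Qed.

(** * Continuity of maps into the path space *)

Section PathSpace.
Variables (R : realType) (X : topologicalType).

Lemma nbhs_path_space (w : path_space R X) (K : set (unit_interval R))
    (O : set X) : compact K -> open O -> path_fun w @` K `<=` O ->
  \forall v \near w, path_fun v @` K `<=` O.
Proof.
move=> cK oO wKO; apply: (@initial_continuous _ _ (@path_fun R X) w
  [set g | g @` K `<=` O]).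
by apply: open_nbhs_nbhs; split=> //; exact: compact_open_open.
Qed.

(** The sets of paths carrying a compact [K] into an open [O] form a subbase of the compact-open
    topology, which [path_space] pulls back along [path_fun]; hence these sets suffice for testing
    convergence. *)
Lemma cvg_path_space {T : Type} (F : set_system T) (s : T -> path_space R X)
    (w : path_space R X) : Filter F ->
  (forall K O, compact K -> open O -> path_fun w @` K `<=` O ->
    \forall z \near F, path_fun (s z) @` K `<=` O) ->
  s @ F --> w.
Proof.
move=> FF wF.
have cs : (@path_fun R X \o s) @ F --> path_fun w.
  by apply/compact_open_cvgP => K O; exact: wF.
move=> B [_ [[C oC <-] Cw CB]]; apply: (filterS CB).
by apply: cs; exact: open_nbhs_nbhs.
Qed.

End PathSpace.

(* [x0] only serves to define [s] outside [V]. *)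
Lemma path_space_curry (R : realType) (X Z : topologicalType) (V : set Z)
    (h : Z * unit_interval R -> X) (x0 : Z -> X) :
  open V -> (forall z t, V z -> {for (z, t), continuous h}) ->
  exists s : Z -> path_space R X,
    (forall z, V z -> {for z, continuous s}) /\
    forall z t, V z -> path_fun (s z) t = h (z, t).
Proof.
move=> oV ch.
have /choice[s sE] z : exists w : path_space R X,
    V z -> forall t, path_fun w t = h (z, t).
  have [Vz|nVz] := pselect (V z); last first.
    by exists (mkcts (@cst_continuous (unit_interval R) X (x0 z))).
  have hz : continuous (fun t => h (z, t)).
    move=> t; apply: (@continuous_comp _ _ _ (pair z) h); last exact: ch.
    by apply: continuous_pair; [exact: cst_continuous|exact: cvg_id].
  by exists (mkcts hz).
exists s; split=> [z Vz|z t /sE//].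
apply: cvg_path_space => K O cK oO sKO.
have VV : \forall z' \near z, V z' by exact: open_nbhs_nbhs.
near=> z' => _ [t Kt <-]; rewrite sE; last exact: (near VV z').
(* Tube argument: each [t] in [K] has a product neighbourhood of [(z, t)] sent into [O], and
   compactness of [K] yields one neighbourhood of [z] valid for all [t]. *)
move: t Kt; near: z'.
move/compact_near_coveringP/near_covering_withinP : cK; apply.
move=> t Kt; have [[P Q] [Pz Qt] PQO] : nbhs (z, t) (h @^-1` O).
  apply: ch => //; apply: open_nbhs_nbhs; split=> //.
  by rewrite -sE//; apply: sKO; exists t.
by exists (Q, P) => // -[b c] /= [Qb Pc] _; exact: PQO.
Unshelve. all: by end_near. Qed.

(** Open sets of [A] are traces of open sets [B] of [X], so a path in [A] sends [K] into the trace
    exactly when it sends [K] into [B] as a path in [X]. Outside [V] the values are constant paths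
    at [y0]. *)
Lemma path_space_corestrict (R : realType) (X Z : topologicalType) (A : set X)
    (V : set Z) (s : Z -> path_space R X) (y0 : Z -> A) :
  open V -> (forall z, V z -> {for z, continuous s}) ->
  (forall z t, V z -> A (path_fun (s z) t)) ->
  exists s' : Z -> path_space R A,
    (forall z, V z -> {for z, continuous s'}) /\
    forall z t, V z -> set_val (path_fun (s' z) t) = path_fun (s z) t.
Proof.
move=> oV cs sA.
have /choice[s' s'E] z : exists w : path_space R A,
    V z -> forall t, set_val (path_fun w t) = path_fun (s z) t.
  have [Vz|nVz] := pselect (V z); last first.
    by exists (mkcts (@cst_continuous (unit_interval R) A (y0 z))).
  pose f t : A := SigSub (mem_set (sA z t Vz)).
  have cf : continuous f.
    by apply: continuous_comp_initial; exact: (@cts_fun _ _ (s z)).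
  by exists (mkcts cf).
exists s'; split=> [z Vz|z t Vz]; last by rewrite s'E.
apply: cvg_path_space => K _ cK [B oB <-] sKO.
have VV : \forall z' \near z, V z' by exact: open_nbhs_nbhs.
have sB : \forall z' \near z, path_fun (s z') @` K `<=` B.
  apply: (cs z Vz [set v | path_fun v @` K `<=` B]).
  apply: nbhs_path_space cK oB _.
  by move=> _ [t Kt <-]; rewrite -s'E//; apply: sKO; exists t.
near=> z' => _ [t Kt <-] /=; rewrite s'E; last exact: (near VV z').
by apply: (near sB z') => //; exists t.
Unshelve. all: by end_near. Qed.

(** * Transfer of covers and motion planners to a subspace *)

Definition val_pair {X : Type} {A : set X} (p : A * A) : X * X :=
  (set_val p.1, set_val p.2).

Lemma val_pair_continuous (X : topologicalType) (A : set X) :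
  continuous (@val_pair X A).
Proof.
move=> p; apply: (@continuous_pair _ _ _ (set_val \o fst) (set_val \o snd));
  apply: continuous_comp;
  [exact: cvg_fst|exact: set_val_continuous|
   exact: cvg_snd|exact: set_val_continuous].
Qed.

(** Common last step of both inequalities: the planner may be built with paths in [X], provided they
    stay in [A]. Equivariance is automatic for the trivial group. *)
Lemma has_motion_planner_subset (R : realType) (X : topologicalType)
    (A : set X) (V : set (A * A)) (s : A * A -> path_space R X) :
  open V -> (forall p, V p -> {for p, continuous s}) ->
  (forall p t, V p -> A (path_fun (s p) t)) ->
  (forall p, V p -> path_ends (s p) = val_pair p) ->
  has_motion_planner R (trivial_action A) V.
Proof.
move=> oV cs sA ends.
have [s' [cs' s'E]] := path_space_corestrict fst oV cs sA.
exists s'; split; first split.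
- by apply/within_openE.
- by move=> g p _; apply/continuousEP => t; case: p.
- move=> p Vp; have [e0 e1] := ends p Vp; rewrite [p in RHS]surjective_pairing.
  by congr (_, _); apply: val_inj; rewrite -!set_valE s'E.
Qed.

Lemma least_number_le (R : realType) (P Q : set nat) :
  P `<=` Q -> (least_number R Q <= least_number R P)%E.
Proof. by move=> PQ; apply/ereal_inf_le_tmp/image_subset. Qed.

(** The group [K] and its action are arbitrary, so that both the diagonal action of [G] and the
    action of [G * G] are covered. *)
Lemma gcovered_preimage (X : topologicalType) (A : set X)
    (K : topologicalGroupType) (b : gaction K (X * X)%type)
    (good : set (set (X * X))) (good' : set (set (A * A))) (n : nat) :
  (forall U, open U -> ginvariant b U -> good U ->
    good' (@val_pair X A @^-1` U)) ->
  gcovered b good n ->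
  gcovered (diag_action (trivial_action A)) good' n.
Proof.
move=> gg' [U [Ui UT]]; exists (fun i => @val_pair X A @^-1` U i); split.
  move=> i; have [oU iU gU] := Ui i; split; last exact: gg'.
    by apply: open_comp => // p _; exact: val_pair_continuous.
  by move=> g [x y].
rewrite -preimage_bigcup UT; exact: preimage_setT.
Qed.

Lemma gact_fixed (G : topologicalGroupType) (X : topologicalType)
    (a : gaction G X) (g : G) (x : fixed_points a) :
  a g (set_val x) = set_val x.
Proof. exact: (set_valP x g). Qed.

Lemma has_motion_planner_fixed_points (R : realType) (G : topologicalGroupType)
    (X : topologicalType) (a : gaction G X) (U : set (X * X)) :
  open U -> has_motion_planner R a U ->
  has_motion_planner R (trivial_action (fixed_points a))
    (@val_pair X (fixed_points a) @^-1` U).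
Proof.
move=> oU [s [[/within_openE cs sG] ends]].
apply: (@has_motion_planner_subset _ _ _ _ (s \o @val_pair _ _)).
- by apply: open_comp => // p _; exact: val_pair_continuous.
- move=> p Up; apply: continuous_comp; last exact: cs.
  exact: val_pair_continuous.
(* Acting by [g] on the path planned for a fixed pair gives the path planned for the moved pair,
   which is the same pair; so every point of the path is fixed. *)
- move=> p t Up g /=; rewrite -[LHS]/(path_fun (path_act a g (s _)) t).
  by rewrite -sG//= !gact_fixed.
- by move=> p Up; exact: ends.
Qed.

(** * Reparametrization and gluing of paths *)

Section Concatenation.
Variable R : realType.
Let I := unit_interval R.

Lemma clamp_subproof (r : R) : 0 <= Num.max 0 (Num.min 1 r) <= 1.
Proof. by rewrite le_max lexx/= ge_max ler01 ge_min lexx. Qed.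

Definition clamp (r : R) : I :=
  SigSub (mem_unit_interval (clamp_subproof r)).

Lemma clamp_continuous : continuous clamp.
Proof.
apply: continuous_comp_initial => r.
apply: continuous_max; first exact: cst_continuous.
by apply: continuous_min; [exact: cst_continuous|exact: cvg_id].
Qed.

Lemma clamp_le0 (r : R) : r <= 0 -> clamp r = I0 R.
Proof.
move=> r0; apply: val_inj => /=; rewrite min_r; last exact: le_trans ler01.
exact: max_l.
Qed.

Lemma clamp_ge1 (r : R) : 1 <= r -> clamp r = I1 R.
Proof. by move=> r1; apply: val_inj; rewrite /= min_l// max_r. Qed.

(** Away from the level [r] one branch is selected on a whole neighbourhood of [z]. On the level,
    [f] and [g] share their value at [z], so near [z] both branches land in the given
    neighbourhood. *)
Lemma continuous_glue (Z Y : topologicalType) (phi : Z -> R) (r : R)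
    (f g : Z -> Y) (z : Z) :
  {for z, continuous phi} -> {for z, continuous f} -> {for z, continuous g} ->
  (phi z = r -> f z = g z) ->
  {for z, continuous (fun x => if phi x <= r then f x else g x)}.
Proof.
move=> cphi cf cg fg O /= Oz.
change (\forall x \near z, O (if phi x <= r then f x else g x)).
case: (ltgtP (phi z) r) Oz => [lt|gt|eq] Oz.
- have nlt : \forall x \near z, phi x < r.
    by apply: (cphi [set y | y < r]); exact: lt_nbhsl.
  near=> x => /=; rewrite ltW; last exact: (near nlt x).
  by near: x; exact: cf.
- have ngt : \forall x \near z, r < phi x.
    by apply: (cphi [set y | r < y]); exact: lt_nbhsr.
  near=> x => /=; rewrite leNgt (near ngt x)//=.
  by near: x; exact: cg.
- have Ofz : \forall x \near z, O (f x) by exact: cf.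
  have Ogz : \forall x \near z, O (g x) by apply: cg; rewrite -fg.
  near=> x => /=; case: ifP => _; first exact: (near Ofz x).
  exact: (near Ogz x).
Unshelve. all: by end_near. Qed.

End Concatenation.

(** * From compressions to motion planners on the fixed points *)

(** If [a k x] is fixed, then applying [k^-1] to it gives both [a k x] and [x]. For
    [p = (a g x, a h x)], both coordinates are therefore [x]. *)
Lemma daleth_fixed (G : topologicalGroupType) (X : topologicalType)
    (a : gaction G X) (p : X * X) :
  fixed_points a p.1 -> fixed_points a p.2 -> daleth a p -> p.1 = p.2.
Proof.
move=> f1 f2 [[g h] _ [_ [x _ <-]] pE]; move: f1 f2; rewrite -pE /= => f1 f2.
have fix_eq k : fixed_points a (a k x) -> a k x = x.
  by move=> /(_ k^-1%g); rewrite -gactM mulVg gact1.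
by rewrite (fix_eq g f1) (fix_eq h f2).
Qed.

Lemma has_motion_planner_compressible (R : realType)
    (G : topologicalGroupType) (X : topologicalType) (a : gaction G X)
    (U : set (X * X)) :
  open U -> gcompressible R (square_action a) (daleth a) U ->
  has_motion_planner R (trivial_action (fixed_points a))
    (@val_pair X (fixed_points a) @^-1` U).
Proof.
move=> oU [c [_ cU [H [cH HG H0 H1]]]].
set A := fixed_points a; set V := _ @^-1` U; pose I := unit_interval R.
have oV : open V by apply: open_comp => // p _; exact: val_pair_continuous.
have {}cH z t : U z -> {for (z, t), continuous H}.
  move=> Uz; move/within_openE : cH; apply=> //.
  by rewrite setXT; apply: open_comp => // p _; exact: cvg_fst.
(* The elements [(g, g)] of [G * G] fix [val_pair p], hence fix its whole track under [H]; this
   already makes each coordinate of the track fixed by [G]. *)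
have HA p t : V p ->
    A (H (val_pair p, t)).1 /\ A (H (val_pair p, t)).2.
  move=> Vp; suff fixH g : (a g (H (val_pair p, t)).1,
      a g (H (val_pair p, t)).2) = H (val_pair p, t).
    by split=> g; [have /(congr1 fst) := fixH g|have /(congr1 snd) := fixH g].
  rewrite -[LHS](HG (g, g))//; congr (H (_, _)).
  by rewrite /val_pair /= !gact_fixed.
(* The time [2 * t] runs from 0 to 1 on the first half, and [2 - 2 * t] runs back to 0 on the
   second. Clamping makes each branch continuous on the whole interval, as the gluing requires. *)
pose h (z : (A * A) * I) := if set_val z.2 <= 2^-1
  then (H (val_pair z.1, clamp (2 * set_val z.2))).1
  else (H (val_pair z.1, clamp (2 - 2 * set_val z.2))).2.
have cval z : {for z, continuous (fun z : (A * A) * I => set_val z.2)}.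
  by apply: continuous_comp; [exact: cvg_snd|exact: set_val_continuous].
have ch p t : V p -> {for (p, t), continuous h}.
  move=> Vp.
  have cHphi (phi : R -> R) : continuous phi -> {for (p, t), continuous
      (fun z : (A * A) * I => H (val_pair z.1, clamp (phi (set_val z.2))))}.
    move=> cphi; apply: (@continuous_comp _ _ _ (fun z : (A * A) * I =>
      (val_pair z.1, clamp (phi (set_val z.2)))) H); last exact: cH.
    apply: continuous_pair.
      by apply: continuous_comp; [exact: cvg_fst|exact: val_pair_continuous].
    apply: (@continuous_comp _ _ _ (phi \o (fun z : (A * A) * I =>
      set_val z.2))); last exact: clamp_continuous.
    by apply: continuous_comp; [exact: cval|exact: cphi].
  apply: (@continuous_glue _ _ _ (fun z : (A * A) * I => set_val z.2) 2^-1).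
  - exact: cval.
  - apply: continuous_comp; last exact: cvg_fst.
    apply: (cHphi (fun r => 2 * r)) => r.
    by apply: cvgM; [exact: cvg_cst|exact: cvg_id].
  - apply: continuous_comp; last exact: cvg_snd.
    apply: (cHphi (fun r => 2 - 2 * r)) => r; apply: cvgB; first exact: cvg_cst.
    by apply: cvgM; [exact: cvg_cst|exact: cvg_id].
  (* At the midpoint both branches take [H] at time 1, whose value [c (val_pair p)] lies in
     [daleth a] and has fixed coordinates, so the two coordinates agree. *)
  - move=> /= ->; rewrite !clamp_ge1; [|lra..].
    apply: (daleth_fixed (HA p _ Vp).1 (HA p _ Vp).2).
    by rewrite H1//; apply: cU; exists (val_pair p).
have [s [cs sE]] := path_space_curry (fun p => set_val p.1) oV ch.
apply: has_motion_planner_subset oV cs _ _ => [p t Vp|p Vp].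
- rewrite sE// /h; case: ifP => _; first exact: (HA _ _ Vp).1.
  exact: (HA _ _ Vp).2.
(* At both ends the homotopy time is 0, where [H] is the identity: the path starts at the first
   coordinate of [p] and ends at the second. *)
- rewrite /path_ends !sE// /h /=.
  have -> : set_val (I0 R) = 0 :> R by [].
  have -> : set_val (I1 R) = 1 :> R by [].
  rewrite ifT; last lra.
  rewrite ifF; last by apply/negbTE; rewrite -ltNge; lra.
  by rewrite !clamp_le0 ?H0//; [lra..].
Qed.

Unset Implicit Arguments.

Theorem corollary3p26 (R : realType) (G : topologicalGroupType)
    (X : topologicalType) (a : gaction G X)
    (hG : lie_group R G) (cG : compact [set: G])
    (cX : compact [set: X]) (anrX : gANR R a) :
  (TC R (fixed_points a) <= TC_equivariant R a)%E /\
  (TC R (fixed_points a) <= TC_effective R a)%E.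
Proof.
(* Pulling a cover back along [val_pair] keeps its number of members, so each admissible [n] on the
   right is admissible on the left. *)
split; apply: least_number_le => n; apply: gcovered_preimage => U oU iU.
- exact: has_motion_planner_fixed_points.
- exact: has_motion_planner_compressible.
Qed.
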